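(* Let $\Theta$ and $\varphi$ be inner functions such that $\varphi$ divides $\Theta$ (i.e. $I:=\Theta/\varphi$ is inner). Then every unit vector belonging to $\{vg : g\in\mathcal{K}_\varphi,\ v \text{ an inner divisor of } I\}$ is $\varphi(S_\Theta)$-inner, i.e. satisfies $\langle \varphi(S_\Theta)^n h, h\rangle = 0$ for all $n\ge1$.
   Context: $H^2$ is the Hardy space on the unit disk with inner product $\langle f,g\rangle=\int_{\mathbb{T}} f\overline{g}\,dm$. For an inner function $\Theta$, the model space is $\mathcal{K}_\Theta=(\Theta H^2)^\perp$ and $P_\Theta$ is the orthogonal projection of $L^2(\mathbb{T},m)$ onto $\mathcal{K}_\Theta$. The compressed shift is $S_\Theta:\mathcal{K}_\Theta\to\mathcal{K}_\Theta$, $S_\Theta f=P_\Theta(zf)$, and for $\varphi\in H^\infty$ the functional calculus gives $\varphi(S_\Theta)=P_\Theta T_\varphi|_{\mathcal{K}_\Theta}$, where $T_\varphi f=\varphi f$. An inner function $v$ is an inner divisor of an inner function $I$ if $I/v$ is inner. *)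

(* Defs.v *)
(* mathcomp-analysis (Lebesgue integral on [0, 2pi])
   + mathcomp-real-closed complex numbers R[i]. *)
From HB Require Import structures.
From mathcomp Require Import all_boot all_order all_algebra.
From mathcomp Require Import all_classical all_reals all_analysis.
From mathcomp Require Import complex.
Set Implicit Arguments. Unset Strict Implicit. Unset Printing Implicit Defensive.
Import Order.TTheory GRing.Theory Num.Theory.
Import numFieldNormedType.Exports.
Local Open Scope classical_set_scope.
Local Open Scope ring_scope.
Local Open Scope complex_scope.

Section Hardy.
Variable R : realType.

(* The unit circle T is parametrized by t in [0, 2pi], z = e^{it};
   dm = dt / (2 pi).  Functions on T are functions R -> R[i]
   (only their values on [0, 2pi] matter). *)
Definition circ : set R := `[0, 2 * pi]%classic.
Local Notation mu := (@lebesgue_measure R).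

Definition cfun := R -> R[i].

(* |z|^2 *)
Definition sqn (z : R[i]) : R := (complex.Re z) ^+ 2 + (complex.Im z) ^+ 2.

Definition cmeasurable (f : cfun) : Prop :=
  measurable_fun circ (fun x => complex.Re (f x)) /\ measurable_fun circ (fun x => complex.Im (f x)).

(* equality almost everywhere on T *)
Definition circ_ae_eq (f g : cfun) : Prop :=
  {ae mu, forall x, circ x -> f x = g x}.

Definition fmul (f g : cfun) : cfun := fun x => f x * g x.
Definition fsub (f g : cfun) : cfun := fun x => f x - g x.

(* L^2(T, m) *)
Definition L2 (f : cfun) : Prop :=
  cmeasurable f /\ (\int[mu]_(x in circ) ((sqn (f x))%:E) < +oo)%E.

(* integral over T with respect to normalized measure m *)
Definition cint (f : cfun) : R[i] :=
  ((2 * pi)^-1 * Rintegral mu circ (fun x => complex.Re (f x)))%R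
  +i* ((2 * pi)^-1 * Rintegral mu circ (fun x => complex.Im (f x)))%R.

(* <f, g> = \int_T f conj(g) dm *)
Definition hinner (f g : cfun) : R[i] := cint (fun x => f x * (g x)^*).

(* z^n = e^{i n t} *)
Definition zpow (n : int) : cfun :=
  fun t => cos (n%:~R * t) +i* sin (n%:~R * t).

(* Fourier coefficient \hat f(n) = <f, z^n> *)
Definition fourier (f : cfun) (n : int) : R[i] := hinner f (zpow n).

(* Hardy space H^2 (as boundary functions) *)
Definition H2 (f : cfun) : Prop :=
  L2 f /\ forall n : int, (n < 0)%R -> fourier f n = 0.

(* H^infinity (as boundary functions) *)
Definition Hinf (f : cfun) : Prop :=
  cmeasurable f /\ (exists M : R, {ae mu, forall x, circ x -> sqn (f x) <= M})
  /\ forall n : int, (n < 0)%R -> fourier f n = 0.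

(* inner function: H^infinity with unimodular boundary values a.e. *)
Definition inner_fun (f : cfun) : Prop :=
  Hinf f /\ {ae mu, forall x, circ x -> sqn (f x) = 1}.

(* v is an inner divisor of I : I / v is inner *)
Definition inner_divisor (v I : cfun) : Prop :=
  inner_fun v /\ inner_fun I /\ inner_fun (fun x => I x / v x).

(* model space K_Theta = (Theta H^2)^perp in H^2 *)
Definition model_space (Th : cfun) (f : cfun) : Prop :=
  H2 f /\ forall g, H2 g -> hinner f (fmul Th g) = 0.

(* p is the orthogonal projection of f onto K_Theta *)
Definition is_proj (Th f p : cfun) : Prop :=
  model_space Th p /\ forall k, model_space Th k -> hinner (fsub f p) k = 0.

(* P_Theta f (chosen representative; 0 if f has no projection, which
   does not happen for f in L^2) *)
Definition P_Theta (Th f : cfun) : cfun :=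
  match pselect (exists p, is_proj Th f p) with
  | left e => projT1 (cid e)
  | right _ => fun _ => 0
  end.

(* phi(S_Theta) = P_Theta T_phi restricted to K_Theta *)
Definition phi_S (Th phi : cfun) (h : cfun) : cfun := P_Theta Th (fmul phi h).

End Hardy.

(* Main.v *)
Require Import Defs.
From HB Require Import structures.
From mathcomp Require Import all_boot all_order all_algebra.
From mathcomp Require Import all_classical all_reals all_analysis.
From mathcomp Require Import complex.
From mathcomp Require Import measurable_realfun ring lra zify.
Import Order.TTheory GRing.Theory Num.Theory.
Import numFieldNormedType.Exports.
Local Open Scope ring_scope.
Local Open Scope complex_scope.
Set Implicit Arguments.
Unset Strict Implicit.

(** For [h = v g] with [g] in the model space of [phi], [h] lies in the model
    space of [Th], and [<phi^n h, h> = <phi^n g, g> = 0] for [n > 0] because [v]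
    is unimodular and [phi^n g] lies in [phi H^2].  Compressing to the model
    space of [Th] changes [phi^n h] only by elements of [Th H^2], which are
    orthogonal to [h].

    That [Th H^2] is the whole orthogonal complement of the model space in [H^2]
    follows by testing [conj Th * u] against negative frequencies; neither
    completeness of [L^2] nor existence of projections is used ([P_Theta] is [0]
    where there is no projection).  The analytic input is that [H^2] is stable
    under multiplication by inner functions.  It follows from the [L^2]-density
    of trigonometric polynomials, which is reached through indicators of arcs
    (pointwise limits of polynomials in a cosine), Borel sets (Dynkin) and simple
    functions. *)

(** * Integrals of functions compared almost everywhere *)

Section AeIntegral.
Local Open Scope classical_set_scope.
Local Open Scope ereal_scope.
Import HBNNSimple.
Context d (T : measurableType d) (R : realType).
Variable mu : {measure set T -> \bar R}.

(** A simple function below [f], multiplied by the indicator of the complement of the exceptional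
    null set, keeps its integral and lies below [g] everywhere, so it competes in the supremum that
    defines the integral of [g]. *)
Lemma ge0_ae_le_integralT (f g : T -> \bar R) :
  (forall x, 0 <= f x) -> (forall x, 0 <= g x) ->
  {ae mu, forall x, f x <= g x} -> \int[mu]_x f x <= \int[mu]_x g x.
Proof.
move=> f0 g0 [N [mN N0 subN]].
rewrite !ge0_integralTE//; apply: ge_ereal_sup => _ [h /= hf <-].
have mNC : measurable (~` N) by exact: measurableC.
pose k := mul_nnsfun h (indic_nnsfun R mNC).
have kE x : k x = (h x * \1_(~` N) x)%R by [].
have -> : sintegral mu h = sintegral mu k.
  rewrite -!integralT_nnsfun; apply: ge0_ae_eq_integral => //.
  - exact/measurable_EFinP.
  - exact/measurable_EFinP.
  - by move=> x _; rewrite lee_fin; exact: fun_ge0.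
  - by move=> x _; rewrite lee_fin; exact: fun_ge0.
  exists N; split => // x /= Hx; apply: contrapT => Nx; apply: Hx => _.
  have := kE x; rewrite indicE mem_set// mulr1 => E; exact: (congr1 EFin (esym E)).
apply: ereal_sup_ubound; exists k => // x; rewrite kE indicE.
have [Nx|Nx] := pselect (N x).
  by rewrite memNset ?mulr0 ?g0//= => /(_ Nx).
rewrite mem_set// mulr1; apply: (le_trans (hf x)).
by apply: contrapT => fg; apply: Nx; exact: subN.
Qed.

(* Unlike [ae_eq_integral], no measurability is assumed: the integral is a
   supremum over simple functions, which may be cut off on a null set. *)
Lemma ae_eq_integral_nonmeasurable (D : set T) (f g : T -> \bar R) :
  {ae mu, forall x, D x -> f x = g x} ->
  \int[mu]_(x in D) f x = \int[mu]_(x in D) g x.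
Proof.
have ge0_eq (F G : T -> \bar R) : (forall x, 0 <= F x) -> (forall x, 0 <= G x) ->
    {ae mu, forall x, F x = G x} -> \int[mu]_x F x = \int[mu]_x G x.
  move=> F0 G0 FG; apply/eqP; rewrite eq_le; apply/andP; split;
    apply: ge0_ae_le_integralT => //; apply: filterS FG => x ->//.
move=> fg; have {}fg : {ae mu, forall x, (f \_ D) x = (g \_ D) x}.
  apply: filterS fg => x fg; rewrite !patchE; case: ifPn => // /set_mem; exact: fg.
rewrite integral_mkcond [RHS]integral_mkcond integralE [RHS]integralE.
by congr (_ - _); apply: ge0_eq => //; apply: filterS fg => x fg; rewrite ?funepos.unlock ?funeneg.unlock fg.
Qed.

End AeIntegral.

(** * Complex integrals and square-integrable functions on the circle *)

Section ComplexIntegral.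
Variable R : realType.
Local Open Scope classical_set_scope.
Local Notation mu := (@lebesgue_measure R).
Local Notation Re := complex.Re.
Local Notation Im := complex.Im.
Implicit Types (f g h : cfun R) (z w : R[i]).

Lemma aeS (P Q : R -> Prop) : (forall x, P x -> Q x) ->
  {ae mu, forall x, P x} -> {ae mu, forall x, Q x}.
Proof. by move=> PQ; apply: (@filterS _ _ (ae_filter_ringOfSetsType mu)). Qed.

Lemma aeS2 (P Q S : R -> Prop) : (forall x, P x -> Q x -> S x) ->
  {ae mu, forall x, P x} -> {ae mu, forall x, Q x} -> {ae mu, forall x, S x}.
Proof. by move=> PQ; apply: (@filterS2 _ _ (ae_filter_ringOfSetsType mu)). Qed.

Lemma cconjE z : z^*%R = conjc z. Proof. by []. Qed.

Lemma cReD z w : Re (z + w) = Re z + Re w. Proof. by case: z; case: w. Qed.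
Lemma cImD z w : Im (z + w) = Im z + Im w. Proof. by case: z; case: w. Qed.
Lemma cReN z : Re (- z) = - Re z. Proof. by case: z. Qed.
Lemma cReM z w : Re (z * w) = Re z * Re w - Im z * Im w.
Proof. by case: z; case: w. Qed.
Lemma cImM z w : Im (z * w) = Re z * Im w + Im z * Re w.
Proof. by case: z => a b; case: w => c d. Qed.
Lemma cReJ z : Re z^*%R = Re z. Proof. by case: z. Qed.
Lemma cImJ z : Im z^*%R = - Im z. Proof. by case: z. Qed.

Lemma cconjD z w : (z + w)^*%R = z^*%R + w^*%R :> R[i]. Proof. exact: rmorphD. Qed.
Lemma cconjB z w : (z - w)^*%R = z^*%R - w^*%R :> R[i]. Proof. exact: rmorphB. Qed.
Lemma cconjM z w : (z * w)^*%R = z^*%R * w^*%R :> R[i]. Proof. exact: rmorphM. Qed.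
Lemma cconjK z : z^*%R^*%R = z. Proof. exact: conjCK. Qed.

Lemma cReZ (r : R) z : Re (r%:C * z) = r * Re z.
Proof. by case: z => a b; rewrite cReM /= mul0r subr0. Qed.
Lemma cReiZ z : Re ('i%C * z) = - Im z.
Proof. by case: z => a b; rewrite cReM /= mul0r mul1r sub0r. Qed.
Lemma sqnR (r : R) : sqn r%:C = r ^+ 2.
Proof. by rewrite /sqn /= expr0n addr0. Qed.

Lemma sqn_ge0 z : 0 <= sqn z.
Proof. by rewrite /sqn addr_ge0// sqr_ge0. Qed.

Lemma sqnM z w : sqn (z * w) = sqn z * sqn w.
Proof. by rewrite /sqn cReM cImM; ring. Qed.

Lemma sqnJ z : sqn z^*%R = sqn z.
Proof. by rewrite /sqn cReJ cImJ sqrrN. Qed.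

Lemma sqnE z : (sqn z)%:C = z * z^*%R.
Proof. by case: z => a b; rewrite /sqn cconjE; simpc; congr (_ +i* _) => /=; ring. Qed.

Lemma sqn1_mulJ z : sqn z = 1 -> z * z^*%R = 1.
Proof. by move=> z1; rewrite -sqnE z1. Qed.

Lemma sqnD_le z w : sqn (z + w) <= 2 * sqn z + 2 * sqn w.
Proof.
rewrite /sqn cReD cImD -subr_ge0.
set a := Re z; set b := Im z; set c := Re w; set e := Im w.
have -> : 2 * (a ^+ 2 + b ^+ 2) + 2 * (c ^+ 2 + e ^+ 2)
  - ((a + c) ^+ 2 + (b + e) ^+ 2) = (a - c) ^+ 2 + (b - e) ^+ 2 by ring.
by rewrite addr_ge0// sqr_ge0.
Qed.

Lemma measurable_circ : measurable (@circ R). Proof. exact: measurable_itv. Qed.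
Lemma measurable_circ_mu : measurable (@circ R : set (measurableTypeR R)).
Proof. exact: measurable_itv. Qed.
Hint Resolve measurable_circ measurable_circ_mu : core.

Lemma cmeasurable_cst z : cmeasurable (fun=> z).
Proof. by split; exact: measurable_cst. Qed.

Lemma cmeasurableD f g :
  cmeasurable f -> cmeasurable g -> cmeasurable (fun x => f x + g x).
Proof.
move=> [f1 f2] [g1 g2]; split.
  under eq_fun do rewrite cReD; exact: measurable_funD.
under eq_fun do rewrite cImD; exact: measurable_funD.
Qed.

Lemma cmeasurableM f g :
  cmeasurable f -> cmeasurable g -> cmeasurable (fun x => f x * g x).
Proof.
move=> [f1 f2] [g1 g2]; split.
  under eq_fun do rewrite cReM.
  by apply: measurable_funB; apply: measurable_funM.
under eq_fun do rewrite cImM.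
by apply: measurable_funD; apply: measurable_funM.
Qed.

Lemma cmeasurableJ f : cmeasurable f -> cmeasurable (fun x => (f x)^*%R).
Proof.
move=> [f1 f2]; split.
  by under eq_fun do rewrite cReJ.
under eq_fun do rewrite cImJ.
exact: (measurableT_comp (@oppr_measurable R setT)).
Qed.

Lemma measurable_sqn f : cmeasurable f -> measurable_fun (@circ R) (fun x => sqn (f x)).
Proof. by move=> [f1 f2]; apply: measurable_funD; apply: measurable_funX. Qed.

Definition cintegrable f :=
  mu.-integrable (@circ R) (EFin \o (fun x => Re (f x))) /\
  mu.-integrable (@circ R) (EFin \o (fun x => Im (f x))).

Lemma cint_ae f g : circ_ae_eq f g -> cint f = cint g.
Proof.
move=> fg; rewrite /cint /Rintegral; congr (_ * fine _ +i* (_ * fine _));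
  by apply: ae_eq_integral_nonmeasurable; apply: aeS fg => x fg /fg ->.
Qed.

Lemma cintD f g : cintegrable f -> cintegrable g ->
  cint (fun x => f x + g x) = cint f + cint g.
Proof.
move=> [f1 f2] [g1 g2]; rewrite /cint.
under eq_fun do rewrite cReD.
under [in X in _ +i* X]eq_fun do rewrite cImD.
by rewrite !RintegralD//; simpc; rewrite !mulrDr.
Qed.

Lemma cintZ z f : cintegrable f -> cint (fun x => z * f x) = z * cint f.
Proof.
move=> [f1 f2]; rewrite /cint.
have iZ (r : R) (F : R -> R) : mu.-integrable (@circ R) (EFin \o F) ->
    mu.-integrable (@circ R) (EFin \o (fun x => r * F x)).
  by move=> iF; apply: eq_integrable (integrableZl _ r iF).
under eq_fun do rewrite cReM.
under [in X in _ +i* X]eq_fun do rewrite cImM.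
rewrite RintegralB ?RintegralD//; [|exact: iZ..].
rewrite !RintegralZl//; case: z => a b; simpc.
by congr (_ +i* _) => /=; ring.
Qed.

Lemma cintJ f : cintegrable f -> cint (fun x => (f x)^*%R) = (cint f)^*%R.
Proof.
move=> [f1 f2]; rewrite /cint cconjE /=; congr (_ +i* _).
  by under eq_fun do rewrite cReJ.
under eq_fun do rewrite cImJ -mulN1r.
by rewrite RintegralZl// mulN1r mulrN.
Qed.

Lemma L2_integrable f : L2 f -> mu.-integrable (@circ R) (EFin \o (fun x => sqn (f x))).
Proof.
move=> [mf If]; apply/integrableP; split.
  by apply/measurable_EFinP; exact: measurable_sqn.
by under eq_integral do rewrite /= ger0_norm ?sqn_ge0//.
Qed.

Lemma L2_dominated f (G : R -> R) : cmeasurable f ->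
  mu.-integrable (@circ R) (EFin \o G) ->
  {ae mu, forall x, circ x -> sqn (f x) <= G x} -> L2 f.
Proof.
move=> mf iG fG; split => //.
have mG := measurable_int _ iG.
have [_ IG] := integrableP _ _ _ iG.
apply: le_lt_trans IG; apply: ae_ge0_le_integral => //.
- by move=> x _; rewrite lee_fin sqn_ge0.
- by apply/measurable_EFinP; exact: measurable_sqn.
- exact: measurableT_comp.
- apply: aeS fG => x fG cx; rewrite /= lee_fin.
  exact: le_trans (fG cx) (ler_norm _).
Qed.

Lemma circ_measure : mu (@circ R) = (2 * pi)%:E.
Proof.
rewrite /circ; have := lebesgue_measure_itv `[0, 2 * pi]%R => /= ->.
by rewrite lte_fin mulr_gt0 ?pi_gt0// oppr0 adde0.
Qed.

Lemma circ_integrable_cst (r : R) : mu.-integrable (@circ R) (EFin \o (fun=> r)).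
Proof.
apply: measurable_bounded_integrable.
- exact: measurable_circ.
- by rewrite /= circ_measure ltry.
- exact: measurable_cst.
- exact: bounded_cst.
Qed.

Lemma L2_bounded f (r : R) : cmeasurable f ->
  {ae mu, forall x, circ x -> sqn (f x) <= r} -> L2 f.
Proof. by move=> mf; apply: L2_dominated => //; exact: circ_integrable_cst. Qed.

Lemma L2D f g : L2 f -> L2 g -> L2 (fun x => f x + g x).
Proof.
move=> Lf Lg.
apply: (@L2_dominated _ (fun x => 2 * sqn (f x) + 2 * sqn (g x))).
- by apply: cmeasurableD; [case: Lf|case: Lg].
- have I1 := integrableZl measurable_circ_mu 2 (L2_integrable Lf).
  have I2 := integrableZl measurable_circ_mu 2 (L2_integrable Lg).
  by apply: eq_integrable (integrableD measurable_circ_mu I1 I2).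
- by apply: aeW => x _; exact: sqnD_le.
Qed.

Lemma L2M_bounded f g (r : R) : L2 f -> cmeasurable g ->
  {ae mu, forall x, circ x -> sqn (g x) <= r} -> L2 (fun x => g x * f x).
Proof.
move=> Lf mg gr; apply: (@L2_dominated _ (fun x => r * sqn (f x))).
- by apply: cmeasurableM => //; case: Lf.
- by apply: eq_integrable (integrableZl measurable_circ_mu r (L2_integrable Lf)).
- apply: aeS gr => x gr cx; rewrite sqnM ler_wpM2r ?sqn_ge0//; exact: gr.
Qed.

Lemma L2Z z f : L2 f -> L2 (fun x => z * f x).
Proof.
move=> Lf; apply: (@L2M_bounded _ _ (sqn z) Lf); first exact: cmeasurable_cst.
exact: aeW.
Qed.

Lemma L2B f g : L2 f -> L2 g -> L2 (fun x => f x - g x).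
Proof.
move=> Lf Lg; have := L2D Lf (L2Z (-1) Lg).
by under eq_fun do rewrite mulN1r.
Qed.

Lemma L2J f : L2 f -> L2 (fun x => (f x)^*%R).
Proof.
move=> Lf; apply: (L2_dominated _ (L2_integrable Lf)).
- by apply: cmeasurableJ; case: Lf.
- by apply: aeW => x _; rewrite sqnJ.
Qed.

(** Real and imaginary parts of the product both have the shape [a * c + b * e], which is dominated
    by the integrable function [sqn f + sqn g]. *)
Lemma L2_cintegrable f g : L2 f -> L2 g -> cintegrable (fun x => f x * (g x)^*%R).
Proof.
move=> Lf Lg.
have [m1 m2] : cmeasurable (fun x => f x * (g x)^*%R).
  by apply: cmeasurableM; [case: Lf|apply: cmeasurableJ; case: Lg].
have iS : mu.-integrable (@circ R) (EFin \o (fun x => sqn (f x) + sqn (g x))).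
  apply: eq_integrable (integrableD measurable_circ_mu (L2_integrable Lf) (L2_integrable Lg)) => //.
have bound (a b c e : R) : `|a * c + b * e| <= a ^+ 2 + b ^+ 2 + (c ^+ 2 + e ^+ 2).
  have := sqr_ge0 (a + c); have := sqr_ge0 (a - c).
  have := sqr_ge0 (b + e); have := sqr_ge0 (b - e).
  have := sqr_ge0 a; have := sqr_ge0 b; have := sqr_ge0 c; have := sqr_ge0 e.
  by rewrite ler_norml => *; apply/andP; split; lra.
split; apply: (le_integrable _ _ _ iS) => //; try exact/measurable_EFinP;
  (move=> x _; rewrite /= lee_fin [leRHS]ger0_norm; last exact: addr_ge0 (sqn_ge0 _) (sqn_ge0 _)).
  by rewrite cReM cReJ cImJ mulrN opprK; exact: bound.
have h := bound (Im (f x)) (Re (f x)) (Re (g x)) (- Im (g x)).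
rewrite cImM cReJ cImJ [X in `|X|]addrC; apply: (le_trans h).
by rewrite /sqn sqrrN [X in X + _]addrC.
Qed.

End ComplexIntegral.

(** * The inner product of L^2 and the orthogonality of the characters *)

Section Fourier.
Variable R : realType.
Local Open Scope classical_set_scope.
Local Notation mu := (@lebesgue_measure R).
Local Notation Re := complex.Re.
Local Notation Im := complex.Im.
Implicit Types (f g h : cfun R) (z : R[i]).

Lemma hinner_ae f f' g g' : circ_ae_eq f f' -> circ_ae_eq g g' ->
  hinner f g = hinner f' g'.
Proof. by move=> ff gg; apply: cint_ae; apply: aeS2 ff gg => x e1 e2 cx; rewrite e1// e2. Qed.

Lemma hinnerDl f g h : L2 f -> L2 g -> L2 h ->
  hinner (fun x => f x + g x) h = hinner f h + hinner g h.
Proof.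
move=> Lf Lg Lh; rewrite /hinner -cintD; [|exact: L2_cintegrable..].
by congr cint; apply/funext => x; rewrite mulrDl.
Qed.

Lemma hinnerZl z f h : L2 f -> L2 h -> hinner (fun x => z * f x) h = z * hinner f h.
Proof.
move=> Lf Lh; rewrite /hinner -cintZ; last exact: L2_cintegrable.
by congr cint; apply/funext => x; rewrite mulrA.
Qed.

Lemma hinnerC f g : L2 f -> L2 g -> hinner f g = (hinner g f)^*%R.
Proof.
move=> Lf Lg; rewrite /hinner -cintJ; last exact: L2_cintegrable.
by congr cint; apply/funext => x; rewrite cconjM cconjK mulrC.
Qed.

Lemma hinnerBl f g h : L2 f -> L2 g -> L2 h ->
  hinner (fun x => f x - g x) h = hinner f h - hinner g h.
Proof.
move=> Lf Lg Lh; rewrite -mulN1r -(hinnerZl (-1) Lg Lh) -hinnerDl//; last exact: L2Z.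
by congr hinner; apply/funext => x; rewrite mulN1r.
Qed.

Lemma hinnerDr f g h : L2 f -> L2 g -> L2 h ->
  hinner f (fun x => g x + h x) = hinner f g + hinner f h.
Proof.
move=> Lf Lg Lh; rewrite hinnerC//; last exact: L2D.
by rewrite hinnerDl// cconjD -!hinnerC.
Qed.

Lemma hinnerZr z f h : L2 f -> L2 h -> hinner f (fun x => z * h x) = z^*%R * hinner f h.
Proof.
move=> Lf Lh; rewrite hinnerC//; last exact: L2Z.
by rewrite hinnerZl// cconjM -!hinnerC.
Qed.

Lemma hinnerBr f g h : L2 f -> L2 g -> L2 h ->
  hinner f (fun x => g x - h x) = hinner f g - hinner f h.
Proof.
move=> Lf Lg Lh; rewrite hinnerC//; last exact: L2B.
by rewrite hinnerBl// cconjB -!hinnerC.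
Qed.

Definition normsq f : R := Re (hinner f f).

Lemma normsq_ge0 f : 0 <= normsq f.
Proof.
rewrite /normsq /hinner /cint /= mulr_ge0 ?invr_ge0 ?mulr_ge0 ?pi_ge0//.
by apply: Rintegral_ge0 => x _; rewrite -sqnE/= sqn_ge0.
Qed.

Lemma normsqJ f : normsq (fun x => (f x)^*%R) = normsq f.
Proof.
by rewrite /normsq; congr (Re (cint _)); apply/funext => x; rewrite cconjK mulrC.
Qed.

Lemma normsqZ z f : L2 f -> normsq (fun x => z * f x) = sqn z * normsq f.
Proof.
move=> Lf; rewrite /normsq hinnerZl//; last exact: L2Z.
by rewrite hinnerZr// mulrA -sqnE cReZ.
Qed.

Lemma normsqD f g : L2 f -> L2 g ->
  normsq (fun x => f x + g x) = normsq f + normsq g + 2 * Re (hinner f g).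
Proof.
move=> Lf Lg; rewrite /normsq hinnerDl//; last exact: L2D.
rewrite !hinnerDr// (hinnerC Lg Lf) !cReD cReJ; ring.
Qed.

Lemma normsqB f g : L2 f -> L2 g ->
  normsq (fun x => f x - g x) = normsq f + normsq g - 2 * Re (hinner f g).
Proof.
move=> Lf Lg; rewrite /normsq hinnerBl//; last exact: L2B.
rewrite !hinnerBr// (hinnerC Lg Lf) !(cReD, cReN) cReJ; ring.
Qed.

Lemma normsqD_le f g : L2 f -> L2 g ->
  normsq (fun x => f x + g x) <= 2 * normsq f + 2 * normsq g.
Proof.
move=> Lf Lg; have := normsq_ge0 (fun x => f x - g x).
rewrite normsqB// normsqD//; lra.
Qed.

(** A Cauchy-Schwarz inequality without square roots: expand the squared norms of [d f + g] and
    [d f - g], which are nonnegative. *)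
Lemma Re_hinner_le f g (d : R) : L2 f -> L2 g ->
  2 * d * `|Re (hinner f g)| <= d ^+ 2 * normsq f + normsq g.
Proof.
move=> Lf Lg; have Ldf := L2Z d%:C Lf.
have := normsq_ge0 (fun x => d%:C * f x - g x).
have := normsq_ge0 (fun x => d%:C * f x + g x).
rewrite normsqB// normsqD// normsqZ// hinnerZl// cReZ sqnR.
by case: (ger0P (Re (hinner f g))) => _; lra.
Qed.

(** Continuity of the inner product in the form used later: a number that is a pairing of [f] with
    arbitrarily small functions must vanish. *)
Lemma Re_hinner_eq0 f (c : R) : L2 f ->
  (forall e, 0 < e -> exists g, [/\ L2 g, normsq g <= e & Re (hinner f g) = c]) -> c = 0.
Proof.
move=> Lf H; apply/eqP; apply: contraT => c0.
have c_gt0 : 0 < `|c| by rewrite normr_gt0.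
have N0 := normsq_ge0 f.
have N1 : 0 < normsq f + 1 by lra.
(* For this [d] one has [d ^+ 2 * (normsq f + 1) = d * |c|]; with [normsq g <= d ^+ 2],
   [Re_hinner_le] then yields [2 * d * |c| <= d * |c|], which forces [c = 0]. *)
pose d := `|c| / (normsq f + 1).
have d0 : 0 < d by exact: divr_gt0.
have [g [Lg Ng Hg]] := H (d ^+ 2) (exprn_gt0 2 d0).
have := Re_hinner_le d Lf Lg; rewrite Hg => h.
have : 2 * d * `|c| <= d * `|c|.
  apply: (le_trans h); apply: (@le_trans _ _ (d ^+ 2 * (normsq f + 1))); first lra.
  by rewrite expr2 -mulrA /d mulfVK// gt_eqF.
have := mulr_gt0 d0 c_gt0; lra.
Qed.

Lemma hinner_eq0 f (c : R[i]) : L2 f ->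
  (forall e, 0 < e -> exists g, [/\ L2 g, normsq g <= e & hinner f g = c]) -> c = 0.
Proof.
move=> Lf H.
have R0 : Re c = 0.
  by apply: (Re_hinner_eq0 Lf) => e /H[g [Lg Ng <-]]; exists g.
(* Pairing with [i f] in place of [f] turns the imaginary part into a real part. *)
have I0 : - Im c = 0.
  apply: (Re_hinner_eq0 (L2Z 'i%C Lf)) => e /H[g [Lg Ng <-]]; exists g; split => //.
  by rewrite hinnerZl// cReiZ.
by apply/eqP; rewrite eq_complex /= R0 eqxx -oppr_eq0 I0 eqxx.
Qed.

Lemma zpowD (m n : int) (t : R) : zpow (m + n) t = zpow m t * zpow n t.
Proof. by rewrite /zpow intrD mulrDl sinD cosD; simpc; congr (_ +i* _); ring. Qed.

Lemma zpow0 (t : R) : zpow 0 t = 1.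
Proof. by rewrite /zpow mul0r cos0 sin0. Qed.

Lemma zpowN (n : int) (t : R) : zpow (- n) t = (zpow n t)^*%R.
Proof. by rewrite /zpow cconjE /= mulrNz mulNr cosN sinN. Qed.

Lemma sqn_zpow (n : int) (t : R) : sqn (zpow n t) = 1.
Proof. by rewrite /sqn /= cos2Dsin2. Qed.

Lemma cmeasurable_zpow (n : int) : cmeasurable (@zpow R n).
Proof.
have m : measurable_fun (@circ R) (fun x : R => n%:~R * x).
  by apply: measurable_funM; [exact: measurable_cst|exact: measurable_id].
by split; apply: measurableT_comp m; apply: continuous_measurable_fun;
  [exact: continuous_cos|exact: continuous_sin].
Qed.

Lemma L2_zpow (n : int) : L2 (@zpow R n).
Proof.
apply: (@L2_bounded _ _ 1); first exact: cmeasurable_zpow.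
by apply: aeW => x _; rewrite sqn_zpow.
Qed.

Lemma zpow_2pi (n : int) : zpow n (2 * pi) = 1 :> R[i].
Proof.
have z1 : zpow 1 (2 * pi) = 1 :> R[i].
  by rewrite /zpow mul1r mulr_natl cos2pi sin2pi.
have zn (k : nat) : zpow k (2 * pi) = 1 :> R[i].
  elim: k => [|k IH]; first exact: zpow0.
  by rewrite -addn1 PoszD zpowD IH z1 mulr1.
by case: n => k; [exact: zn|rewrite NegzE zpowN zn conjC1].
Qed.

Lemma Rintegral_is_derive (F f : R -> R) (a b : R) : a < b ->
  (forall x : R, is_derive x (1 : R) F (f x)) -> continuous f ->
  (\int[mu]_(x in `[a, b]) f x)%R = F b - F a.
Proof.
move=> ab dF cf; rewrite /Rintegral (@continuous_FTC2 _ f F)//.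
- exact: continuous_subspaceT.
- have cF : continuous F by move=> x; apply/differentiable_continuous/derivable1_diffP.
  split; first by move=> x _; exact: ex_derive.
    by apply: cvg_at_right_filter; exact: cF.
  by apply: cvg_at_left_filter; exact: cF.
- by move=> x _; rewrite derive1E derive_val.
Qed.

Lemma cint_zpow (n : int) : n != 0 -> cint (@zpow R n) = 0.
Proof.
move=> n0; pose c : R := n%:~R.
have c0 : c != 0 by rewrite intr_eq0.
have := zpow_2pi n => /eqP; rewrite eq_complex => /andP[/eqP/= cosn /eqP/= sinn].
have cc : continuous (fun t : R => c * t) by move=> t; exact: cvgMr.
have p0 : 0 < 2 * pi :> R by rewrite mulr_gt0 ?pi_gt0.
rewrite /cint /zpow /= /circ -/c.
(* Both antiderivatives take equal values at 0 and 2 pi because [n] is an integer, as [cosn] and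
   [sinn] record. *)
have -> : (\int[mu]_(x in `[0%R, 2 * pi]) cos (c * x))%R = 0.
  have d x : is_derive x (1 : R) (fun t => c^-1 * sin (c * t)) (cos (c * x)).
    by apply: is_derive_eq; rewrite !scaler1 /GRing.scale/=; field.
  have k : continuous (fun t : R => cos (c * t)).
    by move=> x; apply: continuous_comp; [exact: cc|exact: continuous_cos].
  by rewrite (Rintegral_is_derive p0 d k) sinn !mulr0 sin0 mulr0 subrr.
have -> : (\int[mu]_(x in `[0%R, 2 * pi]) sin (c * x))%R = 0.
  have d x : is_derive x (1 : R) (fun t => - c^-1 * cos (c * t)) (sin (c * x)).
    by apply: is_derive_eq; rewrite !scaler1 /GRing.scale/=; field.
  have k : continuous (fun t : R => sin (c * t)).
    by move=> x; apply: continuous_comp; [exact: cc|exact: continuous_sin].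
  by rewrite (Rintegral_is_derive p0 d k) cosn !mulr0 cos0 subrr.
by rewrite mulr0.
Qed.

Lemma hinner_zpow (m n : int) : m != n -> hinner (@zpow R m) (zpow n) = 0.
Proof.
move=> mn; rewrite /hinner -(@cint_zpow (m - n)) ?subr_eq0//.
by congr cint; apply/funext => t; rewrite zpowD zpowN.
Qed.

End Fourier.

(** * Trigonometric polynomials and products in H^2 *)

Section HardySpace.
Variable R : realType.
Local Open Scope classical_set_scope.
Local Notation mu := (@lebesgue_measure R).
Implicit Types (f g h : cfun R) (z : R[i]) (s : seq (R[i] * int)).

(** The pairs are coefficient and frequency. Frequencies may repeat, so that sums, shifts and
    products of polynomials become plain list operations. *)
Definition trig s : cfun R := fun t => \sum_(a <- s) a.1 * zpow a.2 t.

Definition approximable f := forall e, 0 < e ->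
  exists s, normsq (fun x => f x - trig s x) <= e.

Lemma trig_nil : trig [::] = fun=> 0.
Proof. by apply/funext => t; rewrite /trig big_nil. Qed.

Lemma trig_cons a s : trig (a :: s) = fun t => a.1 * zpow a.2 t + trig s t.
Proof. by apply/funext => t; rewrite /trig big_cons. Qed.

Lemma L2_cst z : L2 (fun=> z : R[i]).
Proof. by apply: (@L2_bounded _ _ (sqn z)); [exact: cmeasurable_cst|exact: aeW]. Qed.

Lemma L2_trig s : L2 (trig s).
Proof.
elim: s => [|a s IH]; first by rewrite trig_nil; exact: L2_cst.
by rewrite trig_cons; apply: L2D => //; apply: L2Z; exact: L2_zpow.
Qed.

Lemma hinner0r f : L2 f -> hinner f (fun=> 0) = 0.
Proof.
move=> Lf; apply: etrans (_ : 0^*%R * hinner f f = 0); last by rewrite conjC0 mul0r.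
by rewrite -hinnerZr//; congr (hinner f _); apply/funext => x; rewrite mul0r.
Qed.

Lemma hinner_trig_eq0 f s : L2 f ->
  (forall a, a \in s -> hinner f (zpow a.2) = 0) -> hinner f (trig s) = 0.
Proof.
move=> Lf; elim: s => [_|a s IH fs]; first by rewrite trig_nil hinner0r.
have Lz := L2_zpow R a.2.
rewrite trig_cons hinnerDr//; [|exact: L2Z|exact: L2_trig].
rewrite hinnerZr// fs ?mem_head// mulr0 add0r IH// => b bs.
by apply: fs; rewrite inE bs orbT.
Qed.

Lemma H2D f g : H2 f -> H2 g -> H2 (fun x => f x + g x).
Proof.
move=> [Lf f0] [Lg g0]; split; first exact: L2D.
move=> n n0; rewrite /fourier hinnerDl//; last exact: L2_zpow.
by rewrite [X in X + _](f0 n n0) [X in _ + X](g0 n n0) addr0.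
Qed.

Lemma H2Z z f : H2 f -> H2 (fun x => z * f x).
Proof.
move=> [Lf f0]; split; first exact: L2Z.
move=> n n0; rewrite /fourier hinnerZl//; last exact: L2_zpow.
by rewrite [X in _ * X](f0 n n0) mulr0.
Qed.

Lemma H2B f g : H2 f -> H2 g -> H2 (fun x => f x - g x).
Proof.
move=> Hf Hg; have := H2D Hf (H2Z (-1) Hg).
by under eq_fun do rewrite mulN1r.
Qed.

Lemma inner_cmeasurable f : inner_fun f -> cmeasurable f.
Proof. by move=> [[]]. Qed.

Lemma inner_bounded f : inner_fun f -> {ae mu, forall x, circ x -> sqn (f x) <= 1}.
Proof. by move=> [_ f1]; apply: aeS f1 => x f1 /f1 ->. Qed.

Lemma inner_H2 f : inner_fun f -> H2 f.
Proof.
move=> If; split; last by case: If => -[_ []].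
exact: L2_bounded (inner_cmeasurable If) (inner_bounded If).
Qed.

Lemma L2_innerM f g : inner_fun f -> L2 g -> L2 (fun x => f x * g x).
Proof.
by move=> If Lg; exact: L2M_bounded Lg (inner_cmeasurable If) (inner_bounded If).
Qed.

Lemma hinner_innerM f g h : inner_fun f ->
  hinner (fun x => f x * g x) (fun x => f x * h x) = hinner g h.
Proof.
move=> [_ f1]; apply: cint_ae; apply: aeS f1 => x f1 cx.
by rewrite cconjM mulrACA sqn1_mulJ ?mul1r// f1.
Qed.

Lemma fourier_zpowM (m n : int) f :
  fourier (fun t => zpow m t * f t) n = fourier f (n - m).
Proof.
rewrite /fourier /hinner; congr cint; apply/funext => t.
by rewrite zpowD zpowN cconjM cconjK; ring.
Qed.

Lemma L2_zpowM (m : int) f : L2 f -> L2 (fun t => zpow m t * f t).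
Proof.
move=> Lf; apply: (@L2M_bounded _ _ _ 1 Lf (cmeasurable_zpow _ _)).
by apply: aeW => x _; rewrite sqn_zpow.
Qed.

(* Dropping the negative frequencies of the approximating polynomial can only
   improve it, by Pythagoras. *)
Lemma analytic_approximable f : H2 f -> approximable f ->
  forall e, 0 < e -> exists2 s, (forall a, a \in s -> 0 <= a.2) &
    normsq (fun x => f x - trig s x) <= e.
Proof.
move=> [Lf f0] af e /af[s Hs].
pose p := [seq a <- s | 0 <= a.2]; pose q := [seq a <- s | ~~ (0 <= a.2)].
have sE : trig s = fun t => trig p t + trig q t.
  apply/funext => t; rewrite /trig /p /q !big_filter.
  by rewrite (bigID (fun a : R[i] * int => 0 <= a.2)).
exists p; first by move=> a; rewrite mem_filter => /andP[].
apply: le_trans Hs; rewrite sE.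
have Lp := L2_trig p; have Lq := L2_trig q; have Lfp := L2B Lf Lp.
under [in leRHS]eq_fun do rewrite opprD addrA.
rewrite (normsqB Lfp Lq) hinner_trig_eq0.
- by rewrite mulr0 subr0 lerDl normsq_ge0.
- exact: Lfp.
- move=> a; rewrite mem_filter -ltNge => /andP[a0 _].
  rewrite hinnerBl//; last exact: L2_zpow.
  rewrite [X in X - _](f0 _ a0) sub0r hinnerC//; last exact: L2_zpow.
  rewrite hinner_trig_eq0 ?conjC0 ?oppr0//; first exact: L2_zpow.
  move=> b; rewrite mem_filter => /andP[b0 _]; apply: hinner_zpow.
  by rewrite lt_eqF// (lt_le_trans a0).
Qed.

(** The Fourier coefficient of [g f] at [n < 0] is the pairing of [F = z^(-n) f] with [conj g]. If
    [s] is an analytic polynomial close to [g], then [F] is orthogonal to [conj s], because only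
    negative coefficients of [f] occur. So the coefficient is also the pairing of [F] with the small
    function [conj (g - s)], and [hinner_eq0] applies. *)
Lemma H2_mul_approximable f g : inner_fun g -> approximable g -> H2 f ->
  H2 (fun x => g x * f x).
Proof.
move=> Ig ag [Lf f0]; have Hg := inner_H2 Ig; have [Lg _] := Hg.
split; first exact: L2_innerM.
move=> n n0; pose F : cfun R := fun t => zpow (- n) t * f t.
have LF : L2 F by exact: L2_zpowM.
apply: (hinner_eq0 LF) => e e0.
have [s s0 Hs] := analytic_approximable Hg ag e0.
have Lgs := L2B Lg (L2_trig s).
exists (fun x => (g x - trig s x)^*%R); split.
- exact: L2J.
- by rewrite normsqJ.
have -> : (fun x => (g x - trig s x)^*%R) = (fun x => (g x)^*%R - (trig s x)^*%R).
  by apply/funext => x; rewrite cconjB.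
rewrite hinnerBr//; [|exact: L2J|by apply: L2J; exact: L2_trig].
have trigJ : (fun x => (trig s x)^*%R) = trig [seq (a.1^*%R, - a.2) | a <- s].
  apply/funext => t; rewrite /trig big_map rmorph_sum; apply: eq_bigr => a _.
  by rewrite /= zpowN -cconjM.
rewrite trigJ hinner_trig_eq0//; last first.
  move=> _ /mapP[a /s0 a0 ->] /=.
  have := fourier_zpowM (- n) (- a.2) f; rewrite /fourier -/F => ->.
  by apply: f0; rewrite opprK addrC subr_lt0 (lt_le_trans n0).
rewrite subr0 /fourier /hinner; congr cint; apply/funext => t.
by rewrite /F cconjK zpowN; ring.
Qed.

End HardySpace.

(** * The L^2 closure of the trigonometric polynomials *)

Section TrigonometricApproximation.
Variable R : realType.
Local Open Scope classical_set_scope.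
Local Notation mu := (@lebesgue_measure R).
Local Notation Re := complex.Re.
Implicit Types (f g : cfun R) (z : R[i]) (s : seq (R[i] * int)) (u v : R -> R).

Definition cplx u : cfun R := fun x => (u x)%:C.

Lemma cmeasurable_cplx u : measurable_fun (@circ R) u -> cmeasurable (cplx u).
Proof. by move=> mu'; split => //; exact: measurable_cst. Qed.

Lemma L2_cplx u (r : R) : measurable_fun (@circ R) u ->
  {ae mu, forall x, circ x -> `|u x| <= r} -> L2 (cplx u).
Proof.
move=> mu' ur; apply: (@L2_bounded _ _ (r ^+ 2)); first exact: cmeasurable_cplx.
apply: aeS ur => x ur cx; rewrite /cplx sqnR -real_normK ?num_real//.
by rewrite ler_sqr ?nnegrE ?normr_ge0// ?ur// (le_trans _ (ur cx)).
Qed.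

Lemma normsqE f : normsq f = (2 * pi)^-1 * (\int[mu]_(x in @circ R) sqn (f x))%R.
Proof.
rewrite /normsq /hinner /cint /=; congr (_ * Rintegral _ _ _).
by apply/funext => x; rewrite -sqnE.
Qed.

Lemma trig_cat s s' : trig (s ++ s') = fun t => trig s t + trig s' t.
Proof. by apply/funext => t; rewrite /trig big_cat. Qed.

Lemma approximable_trig s : approximable (trig s).
Proof.
move=> e e0; exists s; under eq_fun do rewrite subrr.
by rewrite /normsq hinner0r ?ltW//; exact: L2_cst.
Qed.

(** The closure is closed. The two errors [e / 4] add up to [e] since [normsqD_le] costs a factor 2
    on each. *)
Lemma approximable_le_trans f : L2 f ->
  (forall e, 0 < e -> exists g, [/\ L2 g, approximable g &
    normsq (fun x => f x - g x) <= e]) -> approximable f.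
Proof.
move=> Lf H e e0; have e4 : 0 < e / 4 by rewrite divr_gt0.
have [g [Lg ag fg]] := H _ e4; have [s gs] := ag _ e4; exists s.
have Ls := L2_trig s.
have -> : (fun x => f x - trig s x) = fun x => (f x - g x) + (g x - trig s x).
  by apply/funext => x; rewrite addrA subrK.
apply: (le_trans (normsqD_le (L2B Lf Lg) (L2B Lg Ls))); lra.
Qed.

Lemma approximable_ae f g : L2 f -> L2 g -> circ_ae_eq f g ->
  approximable g -> approximable f.
Proof.
move=> Lf Lg fg ag; apply: approximable_le_trans => // e e0; exists g; split => //.
have -> : normsq (fun x => f x - g x) = normsq (fun=> 0 : R[i]).
  by congr Re; apply: hinner_ae; apply: aeS fg => x fg /fg ->; rewrite subrr.
by rewrite /normsq hinner0r ?ltW//; exact: L2_cst.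
Qed.

Lemma approximableD f g : L2 f -> L2 g -> approximable f -> approximable g ->
  approximable (fun x => f x + g x).
Proof.
move=> Lf Lg af ag e e0; have e4 : 0 < e / 4 by rewrite divr_gt0.
have [s fs] := af _ e4; have [s' gs] := ag _ e4; exists (s ++ s').
rewrite trig_cat; have Ls := L2_trig s; have Ls' := L2_trig s'.
under eq_fun do rewrite opprD addrACA.
apply: (le_trans (normsqD_le (L2B Lf Ls) (L2B Lg Ls'))); lra.
Qed.

Lemma trigZ z s : (fun t => z * trig s t) = trig [seq (z * a.1, a.2) | a <- s].
Proof.
apply/funext => t; rewrite /trig big_map mulr_sumr.
by apply: eq_bigr => a _; rewrite mulrA.
Qed.

Lemma approximableZ z f : L2 f -> approximable f -> approximable (fun x => z * f x).
Proof.
move=> Lf af e e0; have N0 := sqn_ge0 z.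
have z1 : 0 < sqn z + 1 by lra.
have [s fs] := af _ (divr_gt0 e0 z1).
exists [seq (z * a.1, a.2) | a <- s]; rewrite -trigZ.
under eq_fun do rewrite -mulrBr.
rewrite normsqZ; last exact: L2B (L2_trig s).
apply: (@le_trans _ _ ((sqn z + 1) * normsq (fun x => f x - trig s x))).
  by rewrite ler_wpM2r ?normsq_ge0//; lra.
by rewrite mulrC -ler_pdivlMr.
Qed.

(** Bounded almost everywhere convergence implies convergence in L^2: the squared differences are
    dominated by the constant [(2 * r) ^+ 2], which is integrable on the circle. *)
Lemma approximable_cvg (u_ : nat -> R -> R) u (r : R) :
  (forall n, measurable_fun (@circ R) (u_ n)) -> measurable_fun (@circ R) u ->
  (forall n, approximable (cplx (u_ n))) ->
  {ae mu, forall x, circ x -> forall n, `|u_ n x| <= r} ->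
  {ae mu, forall x, circ x -> `|u x| <= r} ->
  {ae mu, forall x, circ x -> u_ ^~ x @ \oo --> u x} ->
  approximable (cplx u).
Proof.
move=> mu_ mu' au_ bu_ bu cu.
have Lu_ n : L2 (cplx (u_ n)).
  by apply: (L2_cplx (mu_ n)); apply: aeS bu_ => x bu_ cx; exact: bu_.
apply: approximable_le_trans; first exact: L2_cplx bu.
pose F n x := ((u_ n x - u x) ^+ 2)%:E.
have mF n : measurable_fun (@circ R) (F n).
  by apply/measurable_EFinP; apply: measurable_funX; exact: measurable_funB.
have F0 : {ae mu, forall x, circ x -> F ^~ x @ \oo --> 0%E}.
  apply: aeS cu => x cu cx; apply: cvg_EFin; first exact: nearW.
  have c0 : (u_ n x - u x) @[n --> \oo] --> 0.
    by rewrite -(subrr (u x)); apply: cvgB; [exact: cu|exact: cvg_cst].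
  rewrite (_ : fine \o F ^~ x = fun n => (u_ n x - u x) * (u_ n x - u x)).
    by rewrite -(mulr0 0); exact: cvgM.
  by apply/funext => n; rewrite /F /= expr2.
have bF : {ae mu, forall x, forall n, circ x -> (`|F n x| <= ((2 * r) ^+ 2)%:E)%E}.
  apply: aeS2 bu_ bu => x b1 b2 n cx; rewrite /F /= lee_fin ger0_norm ?sqr_ge0//.
  have := ler_normB (u_ n x) (u x); have := b1 cx n; have := b2 cx.
  have := normr_ge0 (u x) => *.
  by rewrite -real_normK ?num_real// ler_sqr ?nnegrE ?normr_ge0//; lra.
have [_ _] := @dominated_convergence _ _ _ mu _ (@measurable_circ_mu R) F (fun=> 0%E) _ mF
  (@measurable_cst _ _ _ _ _ 0%E) F0 (circ_integrable_cst ((2 * r) ^+ 2)) bF.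
rewrite integral0 => /fine_cvg /cvgr0Pnorm_lt cF e e0.
have p0 : 0 < 2 * pi :> R by rewrite mulr_gt0 ?pi_gt0.
have [N _ HN] := cF _ (mulr_gt0 p0 e0).
exists (cplx (u_ N)); split => //.
rewrite normsqE ler_pdivrMl//; apply: le_trans (ltW (HN N (leqnn N))) => /=.
apply: le_trans (ler_norm _).
rewrite le_eqVlt; apply/orP; left; apply/eqP; congr fine.
by apply: eq_integral => x _; rewrite /F /cplx -rmorphB sqnR -sqrrN opprB.
Qed.

(** Equality here is exact. These functions form an algebra, so polynomials in a cosine stay inside;
    [approximable] is only handled linearly and under limits. *)
Definition trigonometric u := exists s, cplx u = trig s.

Lemma trigonometric_cst (r : R) : trigonometric (fun=> r).
Proof.
exists [:: (r%:C, 0)]; apply/funext => t.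
by rewrite /trig big_seq1 zpow0 mulr1.
Qed.

Lemma trigonometricD u v : trigonometric u -> trigonometric v ->
  trigonometric (fun x => u x + v x).
Proof.
move=> [s us] [s' vs]; exists (s ++ s'); rewrite trig_cat -us -vs.
by apply/funext => t; rewrite /cplx rmorphD.
Qed.

Lemma trigM s s' : (fun t => trig s t * trig s' t) =
  trig [seq (a.1 * b.1, a.2 + b.2) | a <- s, b <- s'].
Proof.
apply/funext => t; rewrite /trig big_allpairs_dep mulr_suml.
apply: eq_bigr => a _; rewrite mulr_sumr; apply: eq_bigr => b _.
by rewrite /= zpowD mulrACA.
Qed.

Lemma trigonometricM u v : trigonometric u -> trigonometric v ->
  trigonometric (fun x => u x * v x).
Proof.
move=> [s us] [s' vs]; exists [seq (a.1 * b.1, a.2 + b.2) | a <- s, b <- s'].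
by rewrite -trigM -us -vs; apply/funext => t; rewrite /cplx rmorphM.
Qed.

Lemma trigonometricZ (r : R) u : trigonometric u -> trigonometric (fun x => r * u x).
Proof. exact: trigonometricM (trigonometric_cst r). Qed.

Lemma trigonometricX u n : trigonometric u -> trigonometric (fun x => u x ^+ n).
Proof.
move=> tu; elim: n => [|n IH].
  by under eq_fun do rewrite expr0; exact: trigonometric_cst.
by under eq_fun do rewrite exprS; exact: trigonometricM.
Qed.

Lemma trigonometric_cosB (c : R) : trigonometric (fun t => cos (t - c)).
Proof.
(* Euler's formula: [cos (t - c)] is half the sum of [e^(-ic) e^(it)] and [e^(ic) e^(-it)]. *)
exists [:: ((zpow (-1) c) / 2, 1); ((zpow 1 c) / 2, -1)]; apply/funext => t.
rewrite /trig big_cons big_seq1 /= /cplx.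
rewrite [_ / 2 * _]mulrAC [zpow 1 c / 2 * _]mulrAC -mulrDl; apply: (mulIf (x := 2)).
  by rewrite pnatr_eq0.
rewrite divfK ?pnatr_eq0// /zpow mulrN1z mul1r !mulNr mul1r !cosN !sinN cosB.
rewrite -[2]/(2%:R) -(rmorph_nat (real_complex R)) -rmorphM.
by simpc; congr (_ +i* _) => /=; ring.
Qed.

End TrigonometricApproximation.

(** * Bernoulli-type inequalities for powers of [1 - x] *)

Section Bernoulli.
Variable R : realFieldType.

Lemma bernoulli_onem (x : R) m : 0 <= x <= 1 -> 1 - m%:R * x <= (1 - x) ^+ m.
Proof.
move=> /andP[x0 x1]; elim: m => [|m IH]; first by rewrite mul0r subr0 expr0.
have m0 : 0 <= m%:R :> R by [].
rewrite exprS -natr1; apply: (@le_trans _ _ ((1 - x) * (1 - m%:R * x))); first nra.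
by rewrite ler_wpM2l// subr_ge0.
Qed.

Lemma exprn_onem_mul_le1 (x : R) m : 0 <= x <= 1 -> (1 - x) ^+ m * (m%:R * x) <= 1.
Proof.
move=> /andP[x0 x1].
(* With the extra 1 the product is nonincreasing in [m], since
   [(1 - x) * (1 + (m + 1) * x) <= 1 + m * x]; this makes the induction go through. *)
suff : (1 - x) ^+ m * (1 + m%:R * x) <= 1.
  by apply: le_trans; rewrite ler_wpM2l ?exprn_ge0 ?subr_ge0// lerDr.
elim: m => [|m IH]; first by rewrite expr0 mul0r addr0 mulr1.
have m0 : 0 <= m%:R :> R by [].
rewrite exprSr -natr1 -mulrA; apply: le_trans IH; apply: ler_wpM2l.
  by rewrite exprn_ge0// subr_ge0.
nra.
Qed.

End Bernoulli.

(** * Indicators of arcs as limits of trigonometric polynomials *)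

Section ArcIndicators.
Variable R : realType.
Local Open Scope classical_set_scope.
Local Notation mu := (@lebesgue_measure R).
Implicit Types (u : R -> R) (A : set R).

Lemma step_poly_itv (y : R) n : 0 <= y <= 1 -> 0 <= (1 - y ^+ n) ^+ (2 ^ n) <= 1.
Proof.
move=> /andP[y0 y1]; have yn0 : 0 <= y ^+ n by exact: exprn_ge0.
have yn1 : y ^+ n <= 1 by exact: exprn_ile1.
by rewrite exprn_ge0 ?subr_ge0//= exprn_ile1 ?subr_ge0// gerBl.
Qed.

(* These polynomials converge to the step function with jump at 1/2 (the same
   as in the Brosowski-Deutsch proof of the Stone-Weierstrass theorem). *)
Lemma cvg_step_poly1 (y : R) : 0 <= y < 2^-1 ->
  (1 - y ^+ n) ^+ (2 ^ n) @[n --> \oo] --> (1 : R).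
Proof.
move=> /andP[y0 y2]; have y1 : y <= 1 by lra.
(* Bernoulli's inequality for [y ^+ n] and exponent [2 ^ n] gives this lower bound, and
   [2 * y < 1]. *)
apply: (@squeeze_cvgr _ _ _ _ (fun n => 1 - (2 * y) ^+ n) (fun=> 1)).
- apply: nearW => n; rewrite (andP (@step_poly_itv y n _)).2 ?y0// andbT.
  rewrite exprMn -natrX; apply: bernoulli_onem.
  by rewrite exprn_ge0//= exprn_ile1.
- rewrite -[X in _ --> X](subr0 (1 : R)); apply: cvgB; first exact: cvg_cst.
  by apply: cvg_expr; rewrite ger0_norm ?mulr_ge0//; lra.
- exact: cvg_cst.
Qed.

Lemma cvg_step_poly0 (y : R) : 2^-1 < y <= 1 ->
  (1 - y ^+ n) ^+ (2 ^ n) @[n --> \oo] --> (0 : R).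
Proof.
move=> /andP[y2 y1]; have y0 : 0 <= y by lra.
(* The upper bound is [exprn_onem_mul_le1] for [y ^+ n] and exponent [2 ^ n], divided by
   [(2 * y) ^+ n]; here [2 * y > 1]. *)
apply: (@squeeze_cvgr _ _ _ _ (fun=> 0) (fun n => (2 * y)^-1 ^+ n)).
- apply: nearW => n; rewrite (andP (@step_poly_itv y n _)).1 ?y0//=.
  rewrite exprVn -[leRHS]mul1r ler_pdivlMr ?exprn_gt0//; last lra.
  rewrite exprMn -natrX; apply: exprn_onem_mul_le1.
  by rewrite exprn_ge0//= exprn_ile1.
- exact: cvg_cst.
- apply: cvg_expr; rewrite ger0_norm ?invr_ge0; last lra.
  by rewrite invf_lt1; lra.
Qed.

Lemma trigonometric_approximable u : trigonometric u -> approximable (cplx u).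
Proof. by move=> [s ->]; exact: approximable_trig. Qed.

Lemma ae_neq (a : R) : {ae mu, forall x, x != a}.
Proof.
exists [set a]; split => //; first exact: lebesgue_measure_set1.
by move=> x /= /negP; rewrite negbK => /eqP.
Qed.

Lemma measurable_indic_circ A : measurable A -> measurable_fun (@circ R) (\1_A : R -> R).
Proof. by move=> mA; exact: measurable_indic. Qed.

Lemma L2_indic A : measurable A -> L2 (cplx (\1_A : R -> R)).
Proof.
move=> mA; apply: (L2_cplx (r := 1) (measurable_indic_circ mA)).
by apply: aeW => x _; rewrite indicE; case: (x \in A); rewrite ?normr1 ?normr0.
Qed.

(* [sin (t / 2) * sin ((b - t) / 2)] is a trigonometric polynomial in [t],
   which on the circle is positive exactly on the arc from [0] to [b]. *)
Lemma approximable_arc (b : R) : 0 < b <= 2 * pi ->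
  approximable (cplx (\1_(`]-oo, b[) : R -> R)).
Proof.
move=> /andP[b0 b2].
(* By the product-to-sum formula [q] is one half minus half the product of sines, so it lies in
   [0, 1] and is below 1/2 exactly where that product is positive. *)
pose q t := 2^-1 - (4^-1 * cos (t - b / 2) + 4^-1 * - cos (b / 2)).
have qE t : q t = 2^-1 - 2^-1 * (sin (t / 2) * sin ((b - t) / 2)).
  rewrite /q; have -> : t - b / 2 = t / 2 - (b - t) / 2 by field.
  have -> : b / 2 = t / 2 + (b - t) / 2 by field.
  by rewrite cosB cosD; field.
have q01 t : 0 <= q t <= 1.
  rewrite /q; have := cos_le1 (t - b / 2); have := cos_geN1 (t - b / 2).
  by have := cos_le1 (b / 2); have := cos_geN1 (b / 2); lra.
have tq : trigonometric q.
  have t1 := trigonometricZ (4^-1) (trigonometric_cosB (b / 2)).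
  have t2 := trigonometric_cst (4^-1 * - cos (b / 2)).
  have := trigonometricD (trigonometric_cst 2^-1)
    (trigonometricZ (-1) (trigonometricD t1 t2)).
  by under eq_fun do rewrite mulN1r.
have tp n : trigonometric (fun t => (1 - q t ^+ n) ^+ (2 ^ n)).
  apply: trigonometricX; have := trigonometricD (trigonometric_cst 1)
    (trigonometricZ (-1) (trigonometricX n tq)).
  by under eq_fun do rewrite mulN1r.
have mq : measurable_fun (@circ R) q.
  apply: measurable_funB => //; apply: measurable_funD => //.
  apply: measurable_funM => //; apply: measurableT_comp.
    by apply: continuous_measurable_fun; exact: continuous_cos.
  exact: measurable_funB.
apply: (@approximable_cvg _ (fun n t => (1 - q t ^+ n) ^+ (2 ^ n)) _ 1).
- move=> n; apply: measurable_funX; apply: measurable_funB => //.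
  exact: measurable_funX.
- by apply: measurable_indic_circ; exact: measurable_itv.
- by move=> n; exact: trigonometric_approximable.
- apply: aeW => x _ n; have /andP[h0 h1] := step_poly_itv n (q01 x).
  by rewrite ger0_norm.
- by apply: aeW => x _; rewrite indicE; case: (_ \in _); rewrite ?normr1 ?normr0.
(* At 0, [b] and 2 pi one of the sines vanishes and [q] equals 1/2, the jump of the step function;
   these points are discarded as a null set. *)
have h2 : {ae mu, forall x, x != b /\ x != 2 * pi}.
  by apply: aeS2 (ae_neq b) (ae_neq (2 * pi)) => x; exact: conj.
apply: aeS2 (ae_neq 0) h2 => x x0 [xb x2]; rewrite /circ/= in_itv/= => /andP[lx xl].
have {}lx : 0 < x by rewrite lt_neqAle eq_sym x0.
have {}xl : x < 2 * pi by rewrite lt_neqAle x2.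
have s1 : 0 < sin (x / 2) by apply: sin_gt0_pi; lra.
have := q01 x; case: (ltrP x b) => [lxb|].
  rewrite indicE mem_set/= ?in_itv//= => /andP[qx _].
  have s2 : 0 < sin ((b - x) / 2) by apply: sin_gt0_pi; lra.
  by apply: cvg_step_poly1; rewrite qx qE; have := mulr_gt0 s1 s2; lra.
rewrite le_eqVlt eq_sym (negbTE xb)/= => lbx /andP[_ qx].
rewrite indicE memNset/=; last by rewrite in_itv/= => /(lt_trans lbx); rewrite ltxx.
have s2 : 0 < sin ((x - b) / 2) by apply: sin_gt0_pi; lra.
apply: cvg_step_poly0; rewrite qx andbT qE.
have -> : (b - x) / 2 = - ((x - b) / 2) by field.
by rewrite sinN; have := mulr_gt0 s1 s2; lra.
Qed.

End ArcIndicators.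

(** * From arcs to Borel sets and simple functions *)

Section BorelIndicators.
Variable R : realType.
Local Open Scope classical_set_scope.
Implicit Types (z : R[i]) (A : set R).

Lemma approximable_cst z : approximable (fun=> z).
Proof.
have -> : (fun=> z) = trig [:: (z, 0)] :> cfun R; last exact: approximable_trig.
by apply/funext => t; rewrite /trig big_seq1 zpow0 mulr1.
Qed.

Lemma approximable_indicC A : measurable A ->
  approximable (cplx (\1_A : R -> R)) -> approximable (cplx (\1_(~` A) : R -> R)).
Proof.
move=> mA aA; have := approximableD (L2_cst 1) (L2Z (-1) (L2_indic mA))
  (approximable_cst 1) (approximableZ (-1) (L2_indic mA) aA).
congr approximable; apply/funext => x.
rewrite /cplx !indicE in_setC mulN1r; case: (x \in A) => /=.
  by rewrite -[1]/(1%:C) -rmorphB subrr.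
by rewrite -[1]/(1%:C) -rmorphB subr0.
Qed.

(** By disjointness the indicators of the finite partial unions are sums of indicators; at each
    point they are eventually constant, so [approximable_cvg] passes to the full union. *)
Lemma approximable_bigcup (F : nat -> set R) : (forall n, measurable (F n)) ->
  trivIset setT F -> (forall n, approximable (cplx (\1_(F n) : R -> R))) ->
  approximable (cplx (\1_(\bigcup_k F k) : R -> R)).
Proof.
move=> mF tF aF; pose U n := \big[setU/set0]_(k < n) F k.
have mU n : measurable (U n) by exact: bigsetU_measurable.
have aU n : approximable (cplx (\1_(U n) : R -> R)).
  elim: n => [|n IH].
    have -> : cplx (\1_(U 0%N)) = fun=> 0; last exact: approximable_cst.
    by apply/funext => x; rewrite /cplx /U big_ord0 indicE in_set0.
  have := approximableD (L2_indic (mU n)) (L2_indic (mF n)) IH (aF n).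
  congr approximable; apply/funext => x; rewrite /cplx -rmorphD; congr (_ %:C).
  have -> : U n.+1 = U n `|` F n by rewrite /U big_ord_recr.
  rewrite !indicE in_setU; case: (boolP (x \in F n)) => xn; last by rewrite orbF addr0.
  rewrite orbT memNset ?add0r// /U -bigcup_mkord => -[k /= kn Fk].
  have kE : k = n by apply: (tF k n I I); exists x; split => //; exact: set_mem.
  by move: kn; rewrite /= kE ltnn.
apply: (@approximable_cvg _ (fun n => \1_(U n)) _ 1) => //.
- by apply: measurable_indic_circ; apply: bigcup_measurable => n _; exact: mF.
- by apply: aeW => x _ n; rewrite indicE; case: (_ \in _); rewrite ?normr1 ?normr0.
- by apply: aeW => x _; rewrite indicE; case: (_ \in _); rewrite ?normr1 ?normr0.
apply: aeW => x _; apply: cvg_near_cst.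
have [[k _ Fk]|nF] := pselect ((\bigcup_k F k) x).
  exists k.+1 => // n /= kn; rewrite !indicE !mem_set//; first by exists k.
  by rewrite /U -bigcup_mkord; exists k.
apply: nearW => n; rewrite !indicE !memNset// /U -bigcup_mkord => -[k _ Fk].
by apply: nF; exists k.
Qed.

Lemma approximable_indic A : measurable A -> approximable (cplx (\1_A : R -> R)).
Proof.
move=> mA; pose P := [set B : set R | approximable (cplx (\1_B : R -> R))].
have ray (b : R) : P `]-oo, b[.
  have mb : measurable (`]-oo, b[ : set R) by exact: measurable_itv.
  (* Only [0, 2 pi] matters: there the indicator of the ray is 0 if [b <= 0], 1 if [b > 2 * pi], and
     that of an arc otherwise. *)
  have [b0|b0] := lerP b 0.
    apply: approximable_ae (L2_indic mb) (L2_cst 0) _ (approximable_cst 0).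
    apply: aeW => x; rewrite /circ/= in_itv/= => /andP[x0 _].
    by rewrite /cplx indicE memNset//= in_itv/= => xb; lra.
  have [b2|b2] := lerP b (2 * pi); first by apply: approximable_arc; rewrite b0.
  apply: approximable_ae (L2_indic mb) (L2_cst 1) _ (approximable_cst 1).
  apply: aeW => x; rewrite /circ/= in_itv/= => /andP[_ x2].
  by rewrite /cplx indicE mem_set//= in_itv/=; lra.
suff : P A by [].
(* Open left rays generate the Borel sets and are stable under intersection, so closure under
   complements and disjoint unions suffices. *)
apply: (@dynkin_induction _ (measurableTypeR R) (@RGenInftyO.G R)) => //.
- exact: RGenInftyO.measurableE.
- move=> _ _ [a ->] [b ->]; exists (Num.min a b).
  apply/seteqP; split => x /=; rewrite !in_itv/= lt_min; first by case=> -> ->.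
  by case/andP=> -> ->.
- rewrite /P/= (_ : cplx _ = fun=> 1); first exact: approximable_cst.
  by apply/funext => x; rewrite /cplx indicE in_setT.
- by move=> _ [b ->]; exact: ray.
- by move=> S mS; exact: approximable_indicC.
- by move=> F mF tF; exact: approximable_bigcup.
- by have <- : @measurable _ (measurableTypeR R) = <<s @RGenInftyO.G R >>
    by exact: RGenInftyO.measurableE.
Qed.

Import HBNNSimple.

Lemma approximable_nnsfun (g : {nnsfun R >-> R}) : approximable (cplx g).
Proof.
pose term (y : R) : cfun R := fun x => y%:C * cplx \1_(g @^-1` [set y]) x.
have mg (y : R) : measurable (g @^-1` [set y] : set R) by exact: (measurable_sfunP g (measurable_set1 y)).
have Li (y : R) : L2 (cplx (\1_(g @^-1` [set y] : set R) : R -> R)) := L2_indic (mg y).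
have ai (y : R) : approximable (cplx (\1_(g @^-1` [set y] : set R) : R -> R)) := approximable_indic (mg y).
have Lt y : L2 (term y) := L2Z _ (Li y).
have at_ y : approximable (term y).
  exact: approximableZ (Li y) (ai y).
(* The induction over the values of [g] carries [L2] along, which [approximableD] requires of both
   summands. *)
suff : L2 (cplx g) /\ approximable (cplx g) by case.
have -> : cplx g = fun x => \sum_(y <- finmap.enum_fset (fset_set (range g))) term y x.
  apply/funext => x; rewrite /cplx fimfunE fsbig_finite//= rmorph_sum.
  by apply: eq_bigr => y _; rewrite /term /cplx -rmorphM.
elim: (finmap.enum_fset _) => [|y s IH].
  rewrite (_ : (fun _ => _) = fun=> 0); first by split; [exact: L2_cst|exact: approximable_cst].
  by apply/funext => x; rewrite big_nil.
rewrite (_ : (fun _ => _) = fun x => term y x + \sum_(y <- s) term y x).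
  by case: IH => Ls as_; split; [exact: L2D|exact: approximableD].
by apply/funext => x; rewrite big_cons.
Qed.

End BorelIndicators.

(** * Inner functions as multipliers of H^2, and the backward shift *)

Section InnerFunctions.
Variable R : realType.
Local Open Scope classical_set_scope.
Local Notation mu := (@lebesgue_measure R).
Local Notation Re := complex.Re.
Local Notation Im := complex.Im.
Implicit Types (f g phi : cfun R) (u : R -> R) (s : seq (R[i] * int)).

Import HBNNSimple.

(** Simple functions increasing to [u] inherit its bound [r], so [approximable_cvg] applies to
    them. *)
Lemma approximable_ge0 u (r : R) : measurable_fun (@circ R) u ->
  (forall x, 0 <= u x) -> {ae mu, forall x, circ x -> u x <= r} -> approximable (cplx u).
Proof.
move=> mu' u0 ur.
have [g [ndg cg]] := approximation (@measurable_circ R) ((measurable_EFinP _ _).2 mu')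
  (fun x _ => u0 x : (0 <= (u x)%:E)%E).
have gu n x : circ x -> g n x <= u x.
  move=> /cg /fine_cvg cgx.
  have <- : limn (fun n => g n x) = u x by apply/cvg_lim.
  apply: (@nondecreasing_cvgn_le _ (fun n => g n x)).
    by move=> a b ab; move/lefP : (ndg a b ab); exact.
  by apply/cvg_ex; exists (u x).
have g0 n x : 0 <= g n x by exact: fun_ge0.
apply: (@approximable_cvg _ (fun n => g n) _ r) => //.
- by move=> n; exact: measurable_funS (measurable_funPT (g n)).
- by move=> n; exact: approximable_nnsfun.
- apply: aeS ur => x ur cx n; rewrite ger0_norm//; exact: le_trans (gu n x cx) (ur cx).
- by apply: aeS ur => x ur cx; rewrite ger0_norm// ur.
- by apply: aeW => x cx; have /fine_cvg := cg x cx.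
Qed.

Lemma approximable_real u (r : R) : measurable_fun (@circ R) u ->
  {ae mu, forall x, circ x -> `|u x| <= r} -> approximable (cplx u).
Proof.
(* The lower bound on [u] holds only almost everywhere on the circle; truncating at [- r] before
   adding [r] makes [v] nonnegative everywhere, as [approximable_ge0] asks. *)
move=> mu' ur; pose v x := Num.max (u x) (- r) + r.
have mv : measurable_fun (@circ R) v.
  by apply: measurable_funD => //; apply: measurable_maxr.
have v2 : {ae mu, forall x, circ x -> v x <= 2 * r}.
  apply: aeS ur => x ur cx; have := ur cx; rewrite ler_norml /v => /andP[a b].
  by rewrite max_l//; lra.
have v0 x : 0 <= v x by rewrite /v -lerBlDr sub0r le_max lexx orbT.
have av := approximable_ge0 mv v0 v2.
have Lv : L2 (cplx v).
  by apply: (L2_cplx (r := 2 * r) mv); apply: aeS v2 => x v2 cx; rewrite ger0_norm// v2.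
have Lr := L2_cst (- r)%:C.
apply: approximable_ae (approximableD Lv Lr av (approximable_cst _)).
- exact: L2_cplx ur.
- exact: L2D.
- apply: aeS ur => x ur cx; have := ur cx; rewrite ler_norml /cplx /v => /andP[a b].
  by rewrite max_l// -rmorphD addrK.
Qed.

Lemma inner_approximable f : inner_fun f -> approximable f.
Proof.
move=> If; have [m1 m2] := inner_cmeasurable If; have fb := inner_bounded If.
have bound (a b : R) : a ^+ 2 + b ^+ 2 <= 1 -> `|a| <= 1 /\ `|b| <= 1.
  move=> ab; have := sqr_ge0 a; have := sqr_ge0 b; rewrite !ler_norml => b0 a0.
  by split; apply/andP; split; nra.
have b1 : {ae mu, forall x, circ x -> `|Re (f x)| <= 1}.
  by apply: aeS fb => x fb /fb /bound [].
have b2 : {ae mu, forall x, circ x -> `|Im (f x)| <= 1}.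
  by apply: aeS fb => x fb /fb /bound [].
have L1 := L2_cplx m1 b1; have L2' := L2_cplx m2 b2.
have := approximableD L1 (L2Z 'i%C L2') (approximable_real m1 b1)
  (approximableZ 'i%C L2' (approximable_real m2 b2)).
by congr approximable; apply/funext => x; rewrite /cplx [RHS]complexE.
Qed.

Lemma H2_innerM f g : inner_fun g -> H2 f -> H2 (fun x => g x * f x).
Proof. by move=> Ig; exact: H2_mul_approximable (inner_approximable Ig). Qed.

Lemma H2_innerX phi f m : inner_fun phi -> H2 f -> H2 (fun x => phi x ^+ m * f x).
Proof.
move=> Ip Hf; elim: m => [|m IH].
  by rewrite (_ : (fun _ => _) = f)//; apply/funext => x; rewrite mul1r.
rewrite (_ : (fun _ => _) = fun x => phi x * (phi x ^+ m * f x)); first exact: H2_innerM.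
by apply/funext => x; rewrite exprS mulrA.
Qed.

Lemma trig_shift (m : int) s :
  (fun t => zpow m t * trig s t) = trig [seq (a.1, a.2 + m) | a <- s].
Proof.
apply/funext => t; rewrite /trig big_map mulr_sumr.
by apply: eq_bigr => a _; rewrite /= zpowD; ring.
Qed.

Lemma hinner_zpow_id (n : int) : hinner (@zpow R n) (zpow n) = 1.
Proof.
have -> : hinner (@zpow R n) (zpow n) = cint (fun=> 1).
  by congr cint; apply/funext => t; rewrite sqn1_mulJ// sqn_zpow.
rewrite /cint /= !Rintegral_cst; [|exact: measurable_circ_mu..].
rewrite mul0r mulr0 mul1r.
have p0 : 2 * pi != 0 :> R by rewrite gt_eqF// mulr_gt0// pi_gt0.
transitivity ((2 * pi)^-1 * (2 * pi) +i* (0 : R)); last by rewrite mulVf.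
by congr (_ * _ +i* _); exact: (congr1 fine (circ_measure R)).
Qed.

(** This is the backward shift, f minus its mean, divided by z. Multiplication by [zpow (-1)]
    creates only the negative frequency -1, with coefficient [fourier f 0], and the subtracted term
    cancels it. *)
Lemma H2_backward_shift f : H2 f ->
  H2 (fun x => zpow (-1) x * f x - fourier f 0 * zpow (-1) x).
Proof.
move=> [Lf f0]; have L1 := L2_zpow R (-1).
have Lzf := L2_zpowM (-1) Lf; have Lc := L2Z (fourier f 0) L1.
split; first exact: L2B.
move=> n n0; have Ln := L2_zpow R n.
rewrite /fourier hinnerBl// [X in X - _](fourier_zpowM (-1) n f) hinnerZl// opprK.
have [->|n1] := eqVneq n (-1).
  by rewrite addNr hinner_zpow_id mulr1 subrr.
rewrite hinner_zpow 1?eq_sym// mulr0 subr0 f0//.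
by move: n0 n1; lia.
Qed.

End InnerFunctions.

(** * The model space, its complement in H^2, and the compression *)

Section ModelSpace.
Variable R : realType.
Local Open Scope classical_set_scope.
Implicit Types (f g h F u Th phi : cfun R) (s : seq (R[i] * int)).

(** Iterating the backward shift [j] times removes the negative frequencies of [z^(-j) f]; [s]
    collects what was removed. *)
Lemma H2_negative_part f (j : nat) : H2 f -> exists2 s,
  (forall a, a \in s -> a.2 < 0) & H2 (fun x => zpow (- j%:Z) x * f x - trig s x).
Proof.
move=> Hf; elim: j => [|j [s s0 IH]].
  exists [::] => //; rewrite (_ : (fun _ => _) = f)//.
  by apply/funext => x; rewrite trig_nil oppr0 zpow0 mul1r subr0.
have := H2_backward_shift IH; set c := fourier _ 0 => H.
exists ((c, -1) :: [seq (a.1, a.2 + (-1)) | a <- s]).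
  move=> a; rewrite inE => /predU1P[->//|/mapP[b /s0 b0 ->]] /=.
  by rewrite subr_lt0 (lt_trans b0).
rewrite (_ : (fun _ => _) = fun x => zpow (-1) x * (zpow (- j%:Z) x * f x - trig s x) -
    c * zpow (-1) x)//.
apply/funext => x; rewrite trig_cons -trig_shift /=.
have -> : - j.+1%:Z = -1 + (- j%:Z) by lia.
by rewrite zpowD; ring.
Qed.

Lemma H2_hinner_trig_neg f s : H2 f -> (forall a, a \in s -> a.2 < 0) ->
  hinner f (trig s) = 0.
Proof. by move=> [Lf f0] s0; apply: hinner_trig_eq0 => // a /s0; exact: f0. Qed.

(* The model space contains the projection onto H^2 of zbar^j * Th for every
   j > 0, and these functions detect the negative frequencies of conj Th * u. *)
Lemma H2_orthogonal_model_space Th u : inner_fun Th -> H2 u ->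
  (forall k, model_space Th k -> hinner u k = 0) -> H2 (fun x => (Th x)^*%R * u x).
Proof.
move=> IT Hu u_perp; have [Lu _] := Hu; have HT := inner_H2 IT; have [LT _] := HT.
split.
  apply: (@L2M_bounded _ _ _ 1 Lu (cmeasurableJ (inner_cmeasurable IT))).
  by apply: aeS (inner_bounded IT) => x T1 cx; rewrite sqnJ; exact: T1.
move=> n n0; have [j jn] : exists j : nat, n = - j%:Z by exists `|n|%N; lia.
have [s s0 Hk] := H2_negative_part j HT.
have Ls := L2_trig s.
have Lz : L2 (fun x => zpow (- j%:Z) x * Th x) by exact: L2_zpowM.
have Kk : model_space Th (fun x => zpow (- j%:Z) x * Th x - trig s x).
  split=> // g Hg; have [Lg g0] := Hg; have HTg := H2_innerM IT Hg.
  have [LTg _] := HTg.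
  (* The polynomial [s] is orthogonal to [Th g], which lies in H^2. Cancelling [Th] in the remaining
     pairing leaves that of [z^(-j)] with [g], the conjugate of a negative coefficient of [g]. *)
  rewrite hinnerBl// [X in _ - X]hinnerC// (H2_hinner_trig_neg HTg s0) conjC0 subr0.
  rewrite (_ : (fun _ => _) = fun x => Th x * zpow (- j%:Z) x); last first.
    by apply/funext => x; rewrite mulrC.
  rewrite hinner_innerM// hinnerC//; last exact: L2_zpow.
  by rewrite [hinner _ _](g0 _ _) ?conjC0// -jn.
(* Since [u] is in H^2 it does not see [s], and its pairing with [z^n Th] is the coefficient of
   [conj Th * u] at [n]. *)
have := u_perp _ Kk; rewrite hinnerBr// (H2_hinner_trig_neg Hu s0) subr0 -jn => <-.
by rewrite /fourier /hinner; congr cint; apply/funext => x; rewrite cconjM; ring.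
Qed.

Lemma hinner_proj_orthogonal Th f F : inner_fun Th -> model_space Th f -> H2 F ->
  hinner (fun x => Th x * F x) f = 0.
Proof.
move=> IT [[Lf _] f_perp] HF; have [LTF _] := H2_innerM IT HF.
by rewrite hinnerC// [hinner _ _](f_perp _ HF) conjC0.
Qed.

(** One application of the compression. The defect [u = phi F' - p] equals [Th] times an H^2
    function, and so does [phi ^+ m * u]; hence it is orthogonal to [h] and the pairings of
    [phi ^+ m * p] are those of [phi ^+ m.+1 * F']. The H^2 function [F'] stands in for [F], which
    is known only up to a null set. *)
Lemma phi_S_orthogonal Th phi F F' h : inner_fun Th -> inner_fun phi ->
  model_space Th h -> circ_ae_eq F F' -> H2 F' ->
  (forall m, hinner (fun x => phi x ^+ m.+1 * F' x) h = 0) ->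
  H2 (phi_S Th phi F) /\
  forall m, hinner (fun x => phi x ^+ m * phi_S Th phi F x) h = 0.
Proof.
move=> IT Ip Kh FF' HF' F'h; have [[Lh _] _] := Kh.
rewrite /phi_S /P_Theta; case: pselect => [e|_]; last first.
  split; first by have := H2Z 0 HF'; under eq_fun do rewrite mul0r.
  move=> m; rewrite hinnerC//; last first.
    by under eq_fun do rewrite mulr0; exact: L2_cst.
  under [X in hinner _ X]eq_fun do rewrite mulr0.
  by rewrite hinner0r// conjC0.
case: (cid e) => p [/= [Hp _] projp] {e}; have [Lp _] := Hp; split => // m.
pose u : cfun R := fun x => phi x * F' x - p x.
have Hu : H2 u by apply: H2B => //; exact: H2_innerM.
(* This is [u] divided by [Th], since [Th] is unimodular; the defining property of the projection
   makes [u] orthogonal to the model space. *)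
have ps : H2 (fun x => (Th x)^*%R * u x).
  apply: H2_orthogonal_model_space => // k Kk; rewrite -(projp k Kk).
  apply: hinner_ae; last exact: aeW.
  by apply: aeS FF' => x FF' /FF' E; rewrite /u /fsub /fmul E.
have [Lpp _] := H2_innerX m Ip Hp.
have [LpF _] := H2_innerX m.+1 Ip HF'.
have : hinner (fun x => phi x ^+ m.+1 * F' x - phi x ^+ m * p x) h = 0.
  rewrite -[RHS](hinner_proj_orthogonal IT Kh (H2_innerX m Ip ps)).
  apply: hinner_ae; last exact: aeW.
  case: IT => _; apply: aeS => x T1 cx.
  transitivity (phi x ^+ m * (Th x * (Th x)^*%R * u x)); last by ring.
  by rewrite sqn1_mulJ ?T1// /u exprSr; ring.
by rewrite hinnerBl// F'h sub0r => /eqP; rewrite oppr_eq0 => /eqP.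
Qed.

End ModelSpace.

(** * Inner vectors for the compression of multiplication by [phi] *)

Unset Implicit Arguments.

Theorem theorem6p4 (R : realType) (Th phi : cfun R) :
  inner_fun Th -> inner_fun phi ->
  inner_fun (fun x => Th x / phi x) ->
  forall h : cfun R,
    (exists (v g : cfun R),
        inner_divisor v (fun x => Th x / phi x) /\
        model_space phi g /\
        circ_ae_eq h (fmul v g)) ->
    hinner h h = 1 ->
    forall n : nat, (0 < n)%N -> hinner (iter n (phi_S Th phi) h) h = 0.
Proof.
move=> IT Ip II h [v [g [[Iv [_ Iw]] [Kg hvg]]]] _ n n0.
set w : cfun R := fun x => _ in Iw.
have [Hg g_perp] := Kg; have [Lg _] := Hg.
pose h' : cfun R := fun x => v x * g x.
have Hh' : H2 h' by exact: H2_innerM.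
have sqn_neq0 (z : R[i]) : sqn z = 1 -> z != 0.
  by move=> z1; apply: contra_eq_neq z1 => ->; rewrite /sqn /= expr0n addr0 eq_sym oner_eq0.
have ThE : {ae @lebesgue_measure R, forall x, circ x -> Th x = v x * (phi x * w x)}.
  apply: aeS2 Ip.2 Iv.2 => x p1 v1 cx; rewrite /w.
  have := sqn_neq0 _ (p1 cx); have := sqn_neq0 _ (v1 cx) => v0 p0.
  by field; rewrite p0 v0.
have Kh' : model_space Th h'.
  split => // F HF; have Hw := H2_innerM Iw HF.
  (* As [Th = v phi w], cancelling [v] reduces the pairing of [v g] with [Th F] to that of [g] with
     [phi (w F)], and [w F] is in H^2. *)
  rewrite -[RHS](g_perp _ Hw) -[RHS](hinner_innerM _ _ Iv).
  apply: hinner_ae; first exact: aeW.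
  by apply: aeS ThE => x TE /TE E; rewrite /fmul E !mulrA.
have h'_perp m : hinner (fun x => phi x ^+ m.+1 * h' x) h' = 0.
  (* Cancelling [v] again leaves [phi] times the H^2 function [phi ^+ m * g], paired with [g] from
     the model space of [phi]. *)
  rewrite -[RHS](hinner_proj_orthogonal Ip Kg (H2_innerX m Ip Hg)) -[RHS](hinner_innerM _ _ Iv).
  by congr hinner; apply/funext => x; rewrite /h' exprS; ring.
(* Orthogonality is carried for all powers of [phi], because each compression uses up one of them.
   The first one starts from [h] through its representative [h']; later iterates are themselves in
   H^2. *)
have iterP k : H2 (iter k.+1 (phi_S Th phi) h) /\
    forall m, hinner (fun x => phi x ^+ m * iter k.+1 (phi_S Th phi) h x) h' = 0.
  elim: k => [|k [IH1 IH2]]; first exact: phi_S_orthogonal Hh' h'_perp.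
  by apply: (phi_S_orthogonal IT Ip Kh' _ IH1) => //; exact: aeW.
(* The power [m = 0] is the claim, up to replacing [h'] by [h] on a null set. *)
case: n n0 => // n _; have [_ /(_ 0%N) <-] := iterP n.
apply: hinner_ae => //.
by apply: aeW => x _; rewrite mul1r.
Qed.
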